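(* Let $M^n(\rho)$ be a complex space form, $\pi:M^n(\rho)\times\mathbb{R}\to M^n(\rho)$ the projection, $\gamma:I\subset\mathbb{R}\to M^n(\rho)$ a Frenet curve of osculating order $r$ parametrized by arc length, and $\Sigma^2=\pi^{-1}(\gamma)$ the vertical cylinder over $\gamma$. Then $\Sigma^2$ has non-zero parallel mean curvature vector and the $(2,0)$-part of the quadratic form $Q$ vanishes on $\Sigma^2$ if and only if $\rho<0$ and $\gamma$ is a circle in $M^n(\rho)$ with curvature $\kappa=\frac12\sqrt{-\rho(1+3\tau^2)}$, where $\tau$ is the complex torsion of $\gamma$.
   Context: $M^n(\rho)$ denotes $\mathbb{C}P^n(\rho)$, $\mathbb{C}^n$ or $\mathbb{C}H^n(\rho)$ according as $\rho>0$, $\rho=0$ or $\rho<0$ (complex dimension $n$, constant holomorphic sectional curvature $\rho$), with complex structure $J$ and metric $\langle,\rangle$. On $M^n(\rho)\times\mathbb{R}$ with the product metric put $\varphi=J\circ d\pi$, $\xi=\partial/\partial t$, $\eta=dt$, where $t$ is the coordinate on $\mathbb{R}$. A curve $\gamma$ parametrized by arc length is a Frenet curve of osculating order $r$, $1\le r\le 2n$, if there are orthonormal vector fields $E_1=\gamma',\dots,E_r$ along $\gamma$ and positive functions $\kappa_1,\dots,\kappa_{r-1}$ (the curvatures) with $\nabla_{E_1}E_1=\kappa_1E_2$, $\nabla_{E_1}E_i=-\kappa_{i-1}E_{i-1}+\kappa_iE_{i+1}$ for $2\le i\le r-1$, $\nabla_{E_1}E_r=-\kappa_{r-1}E_{r-1}$,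 where $\nabla$ is the Levi-Civita connection of $M^n(\rho)$. A circle is a Frenet curve of order $2$ with constant curvature $\kappa=\kappa_1>0$; its complex torsion is $\tau=\langle E_1,JE_2\rangle$ (which is constant for a circle). For an immersed surface in $M^n(\rho)\times\mathbb{R}$ with second fundamental form $\sigma$ and mean curvature vector $H=\frac12\mathrm{trace}\,\sigma$, $H$ is parallel if $\nabla^\perp H=0$ for the normal connection $\nabla^\perp$. The quadratic form $Q$ is $$Q(X,Y)=8|H|^2\langle\sigma(X,Y),H\rangle-\rho|H|^2\eta(X)\eta(Y)+3\rho\langle\varphi X,H\rangle\langle\varphi Y,H\rangle.$$ For local isothermal coordinates $(u,v)$ and $Z=\frac1{\sqrt2}(\partial_u-i\partial_v)$, the $(2,0)$-part of $Q$ is $Q(Z,Z)\,dz^2$, $z=u+iv$; it vanishes iff $Q(e_1,e_1)=Q(e_2,e_2)$ and $Q(e_1,e_2)=0$ for orthonormal tangent frames $\{e_1,e_2\}$. *)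

(* Defs.v *)
From HB Require Import structures.
From mathcomp Require Import all_boot all_order all_algebra.
From mathcomp Require Import all_classical all_reals all_analysis.
From mathcomp Require Import complex.

Set Implicit Arguments.
Unset Strict Implicit.
Unset Printing Implicit Defensive.

Import Order.TTheory GRing.Theory Num.Theory.
Import numFieldNormedType.Exports.

Local Open Scope classical_set_scope.
Local Open Scope ring_scope.
Local Open Scope complex_scope.

(** * Riemannian manifolds presented by an atlas

    Coordinate vectors are rows. A tangent vector at [p] is represented by the
    family [v : chart N -> 'rV_m] of its components in the charts; [v i] is
    relevant only when [chart_dom i p]. *)

Record riemannian (R : realType) (m : nat) := Riemannian {
  carrier : Type;
  chart : Type;
  chart_dom : chart -> set carrier;
  chart_map : chart -> carrier -> 'rV[R]_m;
  metric : chart -> 'rV[R]_m -> 'M[R]_m  (* Gram matrix of the coordinate fields *)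
}.

Definition inner (R : realType) (m : nat) (G : 'M[R]_m) (v w : 'rV[R]_m) : R :=
  (v *m G *m w^T) 0 0.

Section LeviCivita.
Variables (R : realType) (m : nat) (g : 'rV[R]_m -> 'M[R]_m).

(* [dmetric x l i j] is $\partial_l g_{ij}(x)$. *)
Definition dmetric (x : 'rV[R]_m) (l i j : 'I_m) : R :=
  'D_(delta_mx 0 l) (fun y => g y i j) x.

(* [christoffel x k i j] is $\Gamma^k_{ij}(x)$. *)
Definition christoffel (x : 'rV[R]_m) (k i j : 'I_m) : R :=
  2^-1 * \sum_(l < m) invmx (g x) k l *
    (dmetric x i j l + dmetric x j i l - dmetric x l i j).

(* Covariant derivative at [w], in the direction [d], of the vector field [V]
   along the map [F]. *)
Definition covder (W : normedModType R) (F V : W -> 'rV[R]_m) (w d : W) :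
    'rV[R]_m :=
  \row_k ('D_d V w 0 k +
    \sum_(i < m) \sum_(j < m)
      christoffel (F w) k i j * 'D_d F w 0 i * V w 0 j).

End LeviCivita.

(** * Curves *)

Section Curves.
Variables (R : realType) (m : nat) (N : riemannian R m).
Implicit Types (I : set R) (c : R -> carrier N) (V : chart N -> R -> 'rV[R]_m).

Definition smooth_on (W : normedModType R) (A : set R) (h : R -> W) : Prop :=
  forall (k : nat) (s : R), A s -> derivable (derive1n k h) s 1.

Definition in_chart I c (i : chart N) : set R := [set s | I s /\ chart_dom i (c s)].

Definition smooth_curve I c : Prop :=
  forall i, open (in_chart I c i) /\ smooth_on (in_chart I c i) (chart_map i \o c).

Definition velocity c (i : chart N) (s : R) : 'rV[R]_m :=
  'D_1 (chart_map i \o c) s.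

Definition tangent (p : carrier N) (v : chart N -> 'rV[R]_m) : Prop :=
  exists (e : R) (c : R -> carrier N),
    [/\ 0 < e, smooth_curve `]- e, e[ c, c 0 = p &
        forall i, chart_dom i p -> v i = velocity c i 0].

Definition field_along I c V : Prop :=
  (forall s, I s -> tangent (c s) (V ^~ s)) /\
  (forall i, smooth_on (in_chart I c i) (V i)).

Definition inner_along c (i : chart N) (s : R) (v w : 'rV[R]_m) : R :=
  inner (metric i (chart_map i (c s))) v w.

Definition nabla c V (i : chart N) (s : R) : 'rV[R]_m :=
  covder (metric i) (chart_map i \o c) (V i) s 1.

(* The frame [E] and the curvatures [kappa] are numbered from 1; the values
   [E j] for [j = 0] or [j > r] and [kappa j] for [j = 0] or [j >= r] play no
   role. For [r = 1] the Frenet equations reduce to the geodesic equation. *)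
Definition frenet_frame I c (r : nat) (E : nat -> chart N -> R -> 'rV[R]_m)
    (kappa : nat -> R -> R) : Prop :=
  [/\ smooth_curve I c,
      (forall j, (1 <= j <= r)%N -> field_along I c (E j)) /\
      (forall j, (1 <= j < r)%N ->
         smooth_on I (kappa j) /\ forall s, I s -> 0 < kappa j s),
      forall i s, in_chart I c i s -> E 1%N i s = velocity c i s,
      forall i s, in_chart I c i s -> forall j k,
        (1 <= j <= r)%N -> (1 <= k <= r)%N ->
        inner_along c i s (E j i s) (E k i s) = (j == k)%:R &
      forall i s, in_chart I c i s -> forall j, (1 <= j <= r)%N ->
        nabla c (E j) i s =
          (if (1 < j)%N then - kappa j.-1 s *: E j.-1 i s else 0) +
          (if (j < r)%N then kappa j s *: E j.+1 i s else 0)].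

Definition circle_frame I c (E : nat -> chart N -> R -> 'rV[R]_m) (k : R) :
    Prop :=
  frenet_frame I c 2 E (fun _ _ => k).

End Curves.

(** * Immersed surfaces

    A surface is given by a parametrization [f : 'rV_2 -> carrier N]; a tangent
    vector of the surface at the parameter [x] is represented by its components
    [X : 'rV_2] in the basis of the coordinate fields of the parametrization.
    All quantities below are expressed in the chart [i] of [N]. *)

Section Surfaces.
Variables (R : realType) (m : nat) (N : riemannian R m).
Variables (f : 'rV[R]_2 -> carrier N) (i : chart N).
Implicit Types (x X Y : 'rV[R]_2) (v w : 'rV[R]_m) (a b : 'I_2).

Let F : 'rV[R]_2 -> 'rV[R]_m := chart_map i \o f.

Definition amb x v w : R := inner (metric i (F x)) v w.

Definition partial a x : 'rV[R]_m := 'D_(delta_mx 0 a) F x.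

Definition push x X : 'rV[R]_m := \sum_a X 0 a *: partial a x.

Definition first_form x : 'M[R]_2 :=
  \matrix_(a, b) amb x (partial a x) (partial b x).

Definition induced x X Y : R := inner (first_form x) X Y.

Definition normal_part x v : 'rV[R]_m :=
  v - \sum_a \sum_b
        (invmx (first_form x) a b * amb x v (partial a x)) *: partial b x.

Definition second_form_coef a b x : 'rV[R]_m :=
  normal_part x (covder (metric i) F (partial b) x (delta_mx 0 a)).

Definition second_form x X Y : 'rV[R]_m :=
  \sum_a \sum_b (X 0 a * Y 0 b) *: second_form_coef a b x.

Definition mean_curvature x : 'rV[R]_m :=
  2^-1 *: \sum_a \sum_b invmx (first_form x) a b *: second_form_coef a b x.

Definition normal_connection x a (V : 'rV[R]_2 -> 'rV[R]_m) : 'rV[R]_m :=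
  normal_part x (covder (metric i) F V x (delta_mx 0 a)).

End Surfaces.

Definition nonzero_parallel_mean_curvature (R : realType) (m : nat)
    (N : riemannian R m) (U : set 'rV[R]_2) (f : 'rV[R]_2 -> carrier N) : Prop :=
  forall i x, U x -> chart_dom i (f x) ->
    mean_curvature f i x <> 0 /\
    forall a, normal_connection f i x a (mean_curvature f i) = 0.

(* [psi] expresses the parameters of the surface in terms of local coordinates
   (u, v) ranging over [W]; ['D_(delta_mx 0 0) psi w] and
   ['D_(delta_mx 0 1) psi w] are the coordinate fields of u and v. *)
Definition isothermal (R : realType) (m : nat) (N : riemannian R m)
    (U : set 'rV[R]_2) (f : 'rV[R]_2 -> carrier N)
    (W : set 'rV[R]_2) (psi : 'rV[R]_2 -> 'rV[R]_2) : Prop :=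
  [/\ open W, {in W &, injective psi},
      forall w, W w -> U (psi w) /\ differentiable psi w &
      forall w, W w -> forall i, chart_dom i (f (psi w)) ->
        let du := 'D_(delta_mx 0 0) psi w in
        let dv := 'D_(delta_mx 0 1) psi w in
        [/\ 0 < induced f i (psi w) du du,
            induced f i (psi w) du du = induced f i (psi w) dv dv &
            induced f i (psi w) du dv = 0]].

(* Value at (Z, Z), Z = A + iB, of the complex bilinear extension of [q]. *)
Definition complex_ext (R : realType) (V : Type) (q : V -> V -> R) (A B : V) :
    R[i] :=
  (q A A - q B B) +i* (q A B + q B A).

(* Vanishing of the (2,0)-part of the field [q x] of bilinear forms. *)
Definition part20_vanishes (R : realType) (m : nat) (N : riemannian R m)
    (U : set 'rV[R]_2) (f : 'rV[R]_2 -> carrier N)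
    (q : chart N -> 'rV[R]_2 -> 'rV[R]_2 -> 'rV[R]_2 -> R) : Prop :=
  forall (W : set 'rV[R]_2) (psi : 'rV[R]_2 -> 'rV[R]_2),
    isothermal U f W psi ->
    forall w, W w -> forall i, chart_dom i (f (psi w)) ->
      complex_ext (q i (psi w))
        ((Num.sqrt 2)^-1 *: 'D_(delta_mx 0 0) psi w)
        (- (Num.sqrt 2)^-1 *: 'D_(delta_mx 0 1) psi w) = 0.

(** * Complex space forms

    A complex coordinate vector x + iy is written [row_mx x y]. *)

Section SpaceForms.
Variables (R : realType) (n : nat) (rho : R).

(* v *m Jmx represents i v. *)
Definition Jmx : 'M[R]_(n + n) := block_mx 0 1%:M (- 1%:M) 0.

Definition conf (z : 'rV[R]_(n + n)) : R := 1 + rho / 4 * (z *m z^T) 0 0.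

(* Real part of the Hermitian metric
     ((1 + c|z|^2) |dz|^2 - c |<dz, z>|^2) / (1 + c|z|^2)^2,   c = rho / 4.
   With w = (sqrt |rho| / 2) z this is the Fubini-Study metric
     (4 / rho) ((1 + |w|^2) |dw|^2 - |<dw, w>|^2) / (1 + |w|^2)^2
   for rho > 0, and the Bergman metric
     (4 / -rho) ((1 - |w|^2) |dw|^2 + |<dw, w>|^2) / (1 - |w|^2)^2
   for rho < 0; it has holomorphic sectional curvature rho. *)
Definition space_form_metric (z : 'rV[R]_(n + n)) : 'M[R]_(n + n) :=
  (conf z ^+ 2)^-1 *:
    (conf z *: 1%:M
     - (rho / 4) *: (z^T *m z + (z *m Jmx)^T *m (z *m Jmx))).

(* The points are the lines of C^(n+1); chart [j] consists of the lines not
   contained in the hyperplane w_j = 0, with the affine coordinates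
   w_k / w_j (k <> j) scaled by 2 / sqrt rho. *)
Definition CP : riemannian R (n + n) :=
  @Riemannian R (n + n)
    {L : {vspace 'rV[R[i]]_n.+1} | \dim L == 1%N}
    'I_n.+1
    (fun j L => vpick (val L) 0 j != 0)
    (fun j L => let w := vpick (val L) in
       (2 / Num.sqrt rho) *:
         row_mx (\row_k complex.Re (w 0 (lift j k) / w 0 j))
                (\row_k complex.Im (w 0 (lift j k) / w 0 j)))
    (fun=> space_form_metric).

(* The ball |z|^2 < - 4 / rho. *)
Definition CH : riemannian R (n + n) :=
  @Riemannian R (n + n)
    {z : 'rV[R]_(n + n) | 0 < conf z} unit (fun=> setT) (fun=> val)
    (fun=> space_form_metric).

Definition Cn : riemannian R (n + n) :=
  @Riemannian R (n + n)
    'rV[R]_(n + n) unit (fun=> setT) (fun=> id) (fun _ _ => 1%:M).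

Definition space_form : riemannian R (n + n) :=
  if 0 < rho then CP else if rho < 0 then CH else Cn.

End SpaceForms.

(** * The product with the real line *)

Section Product.
Variables (R : realType) (m : nat) (M : riemannian R m).

Definition prodR : riemannian R (m + 1) :=
  @Riemannian R (m + 1)
    (carrier M * R) (chart M) (fun i p => chart_dom i p.1)
    (fun i p => row_mx (chart_map i p.1) p.2%:M)
    (fun i y => block_mx (metric i (lsubmx y)) 0 0 1%:M).

(* eta = dt *)
Definition eta (v : 'rV[R]_(m + 1)) : R := (rsubmx v) 0 0.

(* The parametrization (s, t) |-> (gamma s, t) of the vertical cylinder
   over gamma, and its domain I x R. *)
Definition cylinder (gamma : R -> carrier M) (x : 'rV[R]_2) : carrier prodR :=
  (gamma (x 0 0), x 0 1).

Definition cylinder_dom (I : set R) : set 'rV[R]_2 := [set x | I (x 0 0)].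

End Product.

Section SpaceFormTimesR.
Variables (R : realType) (n : nat) (rho : R).
Let M := space_form n rho.

(* phi = J o d pi *)
Definition phi (v : 'rV[R]_(n + n + 1)) : 'rV[R]_(n + n + 1) :=
  row_mx (lsubmx v *m Jmx R n) 0.

Definition Qform (f : 'rV[R]_2 -> carrier (prodR M)) (i : chart (prodR M))
    (x X Y : 'rV[R]_2) : R :=
  let H := mean_curvature f i x in
  let dX := push f i x X in
  let dY := push f i x Y in
  8 * amb f i x H H * amb f i x (second_form f i x X Y) H
  - rho * amb f i x H H * eta dX * eta dY
  + 3 * rho * amb f i x (phi dX) H * amb f i x (phi dY) H.

Definition frenet_curve (I : set R) (gamma : R -> carrier M) (r : nat) : Prop :=
  (1 <= r <= 2 * n)%N /\ exists E kappa, frenet_frame I gamma r E kappa.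

Definition complex_torsion (gamma : R -> carrier M)
    (E : nat -> chart M -> R -> 'rV[R]_(n + n)) (i : chart M) (s : R) : R :=
  inner_along gamma i s (E 1%N i s) (E 2%N i s *m Jmx R n).

End SpaceFormTimesR.

(* Main.v *)
Require Import Defs.
From mathcomp Require Import all_boot all_order all_algebra.
From mathcomp Require Import all_classical all_reals all_analysis.
From mathcomp Require Import complex ring lra.

Set Implicit Arguments.
Unset Strict Implicit.
Unset Printing Implicit Defensive.

Import Order.TTheory GRing.Theory Num.Theory.
Import numFieldNormedType.Exports.

Local Open Scope classical_set_scope.
Local Open Scope ring_scope.

(** Parametrize the cylinder by (s, t) |-> (gamma s, t). Since gamma has unit
    speed, (s, t) are isometric coordinates: the first fundamental form is the
    identity, gamma' and the vertical field xi = d/dt are an orthonormal tangent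
    frame, and the normal space at a point consists of the horizontal vectors
    orthogonal to gamma'. The connection of M x R splits, so the only covariant
    derivative that survives is the one of M along gamma ([covder_cylinder]). Hence sigma(gamma', gamma') = nabla gamma' is the only
    non-zero coefficient of the second fundamental form, and
    H = (kappa_1 / 2) E_2, which is read as 0 when the order of gamma is 1.

    Differentiating H along gamma and dropping the tangential part leaves
    (kappa_1' E_2 + kappa_1 kappa_2 E_3) / 2, without the E_3 term when the
    order is 2 ([frenet_normal_connection]). As the curvatures are positive and
    E_2, E_3 are orthonormal, H is non-zero and parallel exactly when the order
    is 2 and kappa_1 is locally constant, that is, when gamma is a circle
    ([nonzero_parallel_cylinder]); the interval being connected, kappa_1 is then
    a constant k.

    In the orthonormal frame (gamma', xi) the form Q is diagonal, with entries
    k^2 (k^2 + 3 rho tau^2 / 4) and - rho k^2 / 4 ([Qform_cylinder]), where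
    <phi gamma', H> = - k tau / 2 because J is an isometry ([inner_J]). A symmetric
    form on a plane has zero (2,0)-part if and only if it is a multiple of the
    metric, so the condition is
    4 k^2 = - rho (1 + 3 tau^2) ([part20_cylinder]). Since k > 0 this forces
    rho < 0, and taking square roots gives the stated curvature. *)

(** * Directional derivatives *)

Section DirectionalDerivatives.
Variable R : realType.

(** The two difference quotients are the same function of the increment. *)
Lemma derive_comp_coord (W : normedModType R) p (h : R -> W) (a : 'I_p)
    (x v : 'rV[R]_p) :
  'D_v (fun y : 'rV[R]_p => h (y 0 a)) x = 'D_(v 0 a) h (x 0 a).
Proof.
rewrite /derive; set q := fun t => _; set q' := fun t => _.
by have -> : q = q' by apply/funext => t; rewrite /q /q' /= !mxE.
Qed.

Lemma derivable_comp_coord (W : normedModType R) p (h : R -> W) (a : 'I_p)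
    (x v : 'rV[R]_p) :
  derivable (fun y : 'rV[R]_p => h (y 0 a)) x v = derivable h (x 0 a) (v 0 a).
Proof.
rewrite /derivable; set q := fun t => _; set q' := fun t => _.
by have -> : q = q' by apply/funext => t; rewrite /q /q' /= !mxE.
Qed.

Lemma is_derive_coord p (a : 'I_p) (x v : 'rV[R]_p) :
  is_derive x v (fun y : 'rV[R]_p => (y 0 a)%:M : 'rV[R]_1) (v 0 a)%:M.
Proof.
have E (j k : 'I_1) : (fun y : 'rV[R]_p => ((y 0 a)%:M : 'rV[R]_1) j k) =
    (fun y => (id : R -> R^o) (y 0 a)).
  by apply/funext => y; rewrite !ord1 mxE eqxx mulr1n.
have d : derivable (fun y : 'rV[R]_p => (y 0 a)%:M : 'rV[R]_1) x v.
  apply/derivable_mxP => j k; rewrite E.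
  by rewrite (derivable_comp_coord (id : R -> R^o)); exact: derivable_id.
split=> //; rewrite derive_mx //; apply/matrixP => j k; rewrite !mxE E.
by rewrite (derive_comp_coord (id : R -> R^o)) derive_id !ord1 eqxx.
Qed.

Lemma derivable_dir (W : normedModType R) (h : R -> W) (s d : R) :
  derivable h s 1 -> derivable h s d.
Proof. by move/derivable1_diffP; exact: diff_derivable. Qed.

Lemma is_derive_row_mx (V : normedModType R) p q (f : V -> 'rV[R]_p)
    (g : V -> 'rV[R]_q) (x v : V) :
  derivable f x v -> derivable g x v ->
  is_derive x v (fun y => row_mx (f y) (g y)) (row_mx ('D_v f x) ('D_v g x)).
Proof.
move=> df dg.
have d : derivable (fun y => row_mx (f y) (g y)) x v.
  move/derivable_mxP : df => df; move/derivable_mxP : dg => dg.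
  apply/derivable_mxP => a b.
  case: (split_ordP b) => b' ->.
  - under eq_fun do rewrite row_mxEl; exact: df.
  - under eq_fun do rewrite row_mxEr; exact: dg.
split => //; rewrite derive_mx //; apply/matrixP => a b; rewrite mxE.
case: (split_ordP b) => b' ->.
- by rewrite row_mxEl (derive_mx df) mxE; under eq_fun do rewrite row_mxEl.
- by rewrite row_mxEr (derive_mx dg) mxE; under eq_fun do rewrite row_mxEr.
Qed.

Lemma is_derive_scale (V : normedModType R) p (k : V -> R) (f : V -> 'rV[R]_p)
    (x v : V) :
  derivable k x v -> derivable f x v ->
  is_derive x v (fun y => k y *: f y) ('D_v k x *: f x + k x *: 'D_v f x).
Proof.
move=> dk df.
have dfij a b := (derivable_mxP _ _ _).1 df a b.
have E a b : (fun y => (k y *: f y) a b) = k * (fun y => f y a b).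
  by apply/funext => y; rewrite mxE.
have d : derivable (fun y => k y *: f y) x v.
  by apply/derivable_mxP => a b; rewrite E; apply: derivableM.
split => //; rewrite derive_mx //; apply/matrixP => a b; rewrite mxE E deriveM//.
by rewrite !mxE (derive_mx df) mxE /GRing.scale /= addrC [f x a b * _]mulrC.
Qed.

Lemma near_coord p (a : 'I_p) (A : set R) (x : 'rV[R]_p) : open A -> A (x 0 a) ->
  \forall y \near x, A ((y : 'rV[R]_p) 0 a).
Proof.
move=> oA Ax.
apply: (@coord_continuous R^o 1 p 0 a x).
exact: open_nbhs_nbhs.
Qed.

Lemma open_coord p (a : 'I_p) (A : set R) :
  open A -> open [set x : 'rV[R]_p | A (x 0 a)].
Proof.
move=> oA; rewrite openE => x /= Ax; exact: near_coord.
Qed.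

Lemma constant_of_derive0 (A : set R) (f : R -> R) :
  is_interval A -> (forall s, A s -> is_derive s 1 f 0) ->
  {in A &, forall s t, f s = f t}.
Proof.
move=> iA df.
have le s t : A s -> A t -> s <= t -> f s = f t.
  move=> As At st.
  have sA u : u \in `[s, t] -> A u by rewrite in_itv /= => ?; exact: (iA s t).
  have [||c _ /eqP] := @MVT_segment R f (fun=> 0) s t st.
  - by move=> u us; apply/df/sA; exact: subset_itv_oo_cc us.
  - by apply: derivable_within_continuous => u us; have [] := df _ (sA _ us).
  - by rewrite mul0r subr_eq0 eq_sym => /eqP.
move=> s t; rewrite !inE => As At.
have [st|/ltW ts] := leP s t; first exact: le.
by rewrite (le t s).
Qed.

End DirectionalDerivatives.

(** * The Levi-Civita connection of a product with the real line *)

Section ProductConnection.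
Variables (R : realType) (m : nat) (N : riemannian R m).

(** For a singular [A] both sides reduce to the block matrix itself, [invmx] being
    the identity there. *)
Lemma invmx_block1 p q (A : 'M[R]_p) :
  invmx (block_mx A 0 0 1%:M) = block_mx (invmx A) 0 0 1%:M :> 'M[R]_(p + q).
Proof.
have U : (block_mx A 0 0 (1%:M : 'M[R]_q) \in unitmx) = (A \in unitmx).
  by rewrite !unitmxE det_ublock det1 mulr1.
have [uA|nuA] := boolP (A \in unitmx); last by rewrite /invmx U (negbTE nuA).
have E : (block_mx A 0 0 1%:M : 'M[R]_(p + q)) *m
    block_mx (invmx A) 0 0 1%:M = 1%:M.
  rewrite mulmx_block mulmxV// !(mulmx0, mul0mx, addr0, add0r) mulmx1.
  by rewrite -scalar_mx_block.
by rewrite -[LHS]mulmx1 -E mulmxA mulVmx ?mul1mx// U.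
Qed.

Lemma split_lshift p q (j : 'I_p) : fintype.split (lshift q j) = inl j.
Proof. exact: (unsplitK (inl j)). Qed.

Lemma split_rshift p q (j : 'I_q) : fintype.split (rshift p j) = inr j.
Proof. exact: (unsplitK (inr j)). Qed.

(** The product metric does not depend on the real coordinate, and its only
    non-constant block is the metric of [N]. *)
Lemma dmetric_prodR (i : chart N) (y : 'rV[R]_(m + 1)) (l a b : 'I_(m + 1)) :
  dmetric (metric (r := prodR N) i) y l a b =
  match fintype.split l, fintype.split a, fintype.split b with
  | inl l', inl a', inl b' => dmetric (metric i) (lsubmx y) l' a' b'
  | _, _, _ => 0
  end.
Proof.
rewrite /dmetric /=.
case: (split_ordP a) => a' ->.
- case: (split_ordP b) => b' ->; last first.
    by under eq_fun do rewrite block_mxEur mxE; rewrite derive_cst;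
      case: fintype.split.
  under eq_fun do rewrite block_mxEul.
  rewrite /derive; case: (split_ordP l) => l' ->; set q := fun t => _.
    set q' := fun t => _; have -> // : q = q'.
    apply/funext => t; rewrite /q /q' /=; congr (_ *: (metric i _ _ _ - _)).
    by apply/matrixP => u v; rewrite !mxE eq_lshift.
  have -> : q = fun=> 0.
    apply/funext => t; rewrite /q /= (_ : lsubmx _ = lsubmx y) ?subrr ?scaler0//.
    by apply/matrixP => u v; rewrite !mxE eq_lrshift andbF mulr0 add0r.
  exact: lim_cst.
- case: (split_ordP b) => b' ->.
    by under eq_fun do rewrite block_mxEdl mxE; rewrite derive_cst;
      case: fintype.split.
  by under eq_fun do rewrite block_mxEdr mxE; rewrite derive_cst;
      case: fintype.split.
Qed.

Lemma christoffel_prodR (i : chart N) (y : 'rV[R]_(m + 1)) (k a b : 'I_(m + 1)) :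
  christoffel (metric (r := prodR N) i) y k a b =
  match fintype.split k, fintype.split a, fintype.split b with
  | inl k', inl a', inl b' => christoffel (metric i) (lsubmx y) k' a' b'
  | _, _, _ => 0
  end.
Proof.
rewrite /christoffel [in X in invmx X]/= invmx_block1.
rewrite big_split_ord /= [X in _ + X]big1 ?addr0; last first.
  move=> l _; rewrite !dmetric_prodR !split_rshift.
  by case: (fintype.split a) => ?; case: (fintype.split b) => ?;
    rewrite addr0 subrr mulr0.
case: (split_ordP k) => k' ->; last first.
  by rewrite big1 ?mulr0 // => l _; rewrite block_mxEdl mxE mul0r.
case: (split_ordP a) => a' ->; case: (split_ordP b) => b' ->;
  try by rewrite big1 ?mulr0// => l _;
    rewrite !dmetric_prodR ?split_lshift ?split_rshift addr0 subrr mulr0.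
congr (_ * _); apply: eq_bigr => l _.
by rewrite block_mxEul !dmetric_prodR !split_lshift.
Qed.

Lemma covder_prodR (W : normedModType R) (i : chart N) (c V : W -> 'rV[R]_m)
    (t u : W -> 'rV[R]_1) (w d : W) :
  derivable c w d -> derivable t w d -> derivable V w d -> derivable u w d ->
  covder (metric (r := prodR N) i) (fun y => row_mx (c y) (t y))
    (fun y => row_mx (V y) (u y)) w d
  = row_mx (covder (metric i) c V w d) ('D_d u w).
Proof.
move=> dc dt dV du; apply/rowP => k; rewrite mxE.
have [_ ->] := is_derive_row_mx dc dt; have [_ ->] := is_derive_row_mx dV du.
case: (split_ordP k) => k' ->.
- rewrite !row_mxEl mxE; congr (_ + _).
  rewrite big_split_ord /= [X in _ + X]big1 ?addr0; last first.
    move=> a _; rewrite big1// => b _.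
    by rewrite christoffel_prodR split_lshift split_rshift !mul0r.
  apply: eq_bigr => a _.
  rewrite big_split_ord /= [X in _ + X]big1 ?addr0; last first.
    by move=> b _; rewrite christoffel_prodR !split_lshift split_rshift !mul0r.
  by apply: eq_bigr => b _;
    rewrite christoffel_prodR !split_lshift !row_mxEl row_mxKl.
- rewrite !row_mxEr big1 ?addr0// => a _; rewrite big1// => b _.
  by rewrite christoffel_prodR split_rshift !mul0r.
Qed.

End ProductConnection.

Section CovariantDerivative.
Variables (R : realType) (m : nat) (g : 'rV[R]_m -> 'M[R]_m).

Lemma covder0 (W : normedModType R) (F V : W -> 'rV[R]_m) (w : W) :
  covder g F V w 0 = 0.
Proof.
apply/rowP => k; rewrite !mxE !derive0 mxE add0r big1// => a _.
by rewrite big1// => b _; rewrite mxE mulr0 mul0r.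
Qed.

Lemma covder_zero (W : normedModType R) (F : W -> 'rV[R]_m) (w d : W) :
  covder g F (fun=> 0) w d = 0.
Proof.
apply/rowP => k; rewrite !mxE derive_cst mxE add0r big1// => a _.
by rewrite big1// => b _; rewrite mxE mulr0.
Qed.

Lemma covder_comp_coord p (c V : R -> 'rV[R]_m) (a : 'I_p) (x v : 'rV[R]_p) :
  covder g (fun y : 'rV[R]_p => c (y 0 a)) (fun y => V (y 0 a)) x v =
  covder g c V (x 0 a) (v 0 a).
Proof. by rewrite /covder !derive_comp_coord. Qed.

Lemma near_eq_covder (W : normedModType R) (F V V' : W -> 'rV[R]_m) (w d : W) :
  (\forall y \near w, V y = V' y) -> covder g F V w d = covder g F V' w d.
Proof. by move=> VV'; rewrite /covder (near_eq_derive d VV') (nbhs_singleton VV'). Qed.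

Lemma covder_scale (W : normedModType R) (F V : W -> 'rV[R]_m) (k : W -> R)
    (w d : W) :
  derivable k w d -> derivable V w d ->
  covder g F (fun y => k y *: V y) w d =
  'D_d k w *: V w + k w *: covder g F V w d.
Proof.
move=> dk dV; apply/rowP => j; rewrite !mxE.
have [_ ->] := is_derive_scale dk dV; rewrite !mxE mulrDr addrA; congr (_ + _).
rewrite mulr_sumr; apply: eq_bigr => a _; rewrite mulr_sumr; apply: eq_bigr => b _.
by rewrite mxE mulrCA.
Qed.

End CovariantDerivative.

(** * Scalar products *)

Section Inner.
Variables (R : realType) (m : nat) (G : 'M[R]_m).
Implicit Types u v w : 'rV[R]_m.

Lemma innerDl u v w : inner G (u + v) w = inner G u w + inner G v w.
Proof. by rewrite /inner !mulmxDl mxE. Qed.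

Lemma innerZl a v w : inner G (a *: v) w = a * inner G v w.
Proof. by rewrite /inner -!scalemxAl mxE. Qed.

Lemma innerZr a v w : inner G v (a *: w) = a * inner G v w.
Proof. by rewrite /inner linearZ /= -scalemxAr mxE. Qed.

Lemma inner0l w : inner G 0 w = 0.
Proof. by rewrite /inner !mul0mx mxE. Qed.

Lemma inner0r w : inner G w 0 = 0.
Proof. by rewrite /inner trmx0 mulmx0 mxE. Qed.

End Inner.

Lemma ord2_cases (d : 'I_2) : d = 0 \/ d = 1.
Proof. by case: d => -[|[|//]] ?; [left|right]; apply/val_inj. Qed.

Lemma sum_ord2 (V : nmodType) (F : 'I_2 -> V) : \sum_a F a = F 0 + F 1.
Proof.
by rewrite big_ord_recl big_ord1; congr (_ + F _); apply/val_inj.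
Qed.

Lemma sum2_ord2 (V : nmodType) (F : 'I_2 -> 'I_2 -> V) :
  \sum_a \sum_b F a b = F 0 0 + F 0 1 + (F 1 0 + F 1 1).
Proof. by rewrite !sum_ord2. Qed.

Lemma sum_id_mx2 (R : pzRingType) (V : lmodType R) (k : 'I_2 -> R) (P : 'I_2 -> V) :
  \sum_a \sum_b ((1%:M : 'M[R]_2) a b * k a) *: P b = k 0 *: P 0 + k 1 *: P 1.
Proof.
by rewrite !sum_ord2 !mxE /= !mul1r !mul0r !scale0r addr0 add0r.
Qed.

Lemma inner_id2 (R : realType) (X Y : 'rV[R]_2) :
  inner 1%:M X Y = X 0 0 * Y 0 0 + X 0 1 * Y 0 1.
Proof.
by rewrite /inner mulmx1 mxE sum_ord2 !mxE.
Qed.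

Lemma inner_prodR (R : realType) (m : nat) (N : riemannian R m) (i : chart N)
    (y : 'rV[R]_(m + 1)) (v w : 'rV[R]_m) (a b : 'rV[R]_1) :
  inner (metric (r := prodR N) i y) (row_mx v a) (row_mx w b) =
  inner (metric i (lsubmx y)) v w + a 0 0 * b 0 0.
Proof.
rewrite /inner /= mul_row_block !mulmx0 addr0 add0r mulmx1 tr_row_mx mul_row_col mxE.
by congr (_ + _); rewrite mxE big_ord1 mxE.
Qed.

(** * Geometry of the cylinder over a unit-speed curve *)

Definition horizontal (R : realType) (m : nat) (v : 'rV[R]_m) : 'rV[R]_(m + 1) :=
  row_mx v 0.

Lemma horizontal_eq0 (R : realType) m (v : 'rV[R]_m) : horizontal v = 0 -> v = 0.
Proof. by move=> /(congr1 (@lsubmx _ _ _ _)); rewrite /horizontal row_mxKl linear0. Qed.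

Section CylinderGeometry.
Variables (R : realType) (m : nat) (N : riemannian R m).
Variables (c : R -> carrier N) (i : chart N) (A : set R).
Hypothesis oA : open A.
Hypothesis smooth : smooth_on A (chart_map i \o c).
Hypothesis unit_speed :
  forall s, A s -> inner_along c i s (velocity c i s) (velocity c i s) = 1.

Let f := cylinder c.

Let vel s : A s -> derivable (chart_map i \o c) s 1.
Proof. by move=> As; exact: (@smooth 0%N _ As). Qed.

Let acc s : A s -> derivable (velocity c i) s 1.
Proof.
move=> As; suff <- : derive1n 1 (chart_map i \o c) = velocity c i by exact: smooth.
by apply/funext => u; rewrite derive1n1 derive1E.
Qed.

Lemma partial_cylinder (x : 'rV[R]_2) : A (x 0 0) ->
  partial f i 0 x = horizontal (velocity c i (x 0 0)) /\
  partial f i 1 x = row_mx 0 1%:M.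
Proof.
move=> Ax; have dc v : derivable (fun y : 'rV[R]_2 => (chart_map i \o c) (y 0 0)) x v.
  by rewrite derivable_comp_coord; apply: derivable_dir; exact: vel.
have D v : 'D_v (chart_map (r := prodR N) i \o f) x =
    row_mx ('D_(v 0 0) (chart_map i \o c) (x 0 0)) (v 0 1)%:M.
  have [dt Et] := is_derive_coord 1 x v.
  have [_ E] := is_derive_row_mx (dc v) dt.
  by rewrite -Et -derive_comp_coord; exact: E.
by split; rewrite /partial D !mxE /= ?derive0 /horizontal ?raddf0.
Qed.

Lemma amb_cylinder (x : 'rV[R]_2) v w a b :
  amb f i x (row_mx v a) (row_mx w b) =
  inner_along c i (x 0 0) v w + a 0 0 * b 0 0.
Proof. by rewrite /amb inner_prodR /= row_mxKl. Qed.

Lemma first_form_cylinder (x : 'rV[R]_2) : A (x 0 0) ->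
  first_form f i x = 1%:M.
Proof.
move=> Ax; have [p0 p1] := partial_cylinder Ax.
apply/matrixP => a b; rewrite !mxE.
case: (ord2_cases a) => ->; case: (ord2_cases b) => ->;
  rewrite ?p0 ?p1 amb_cylinder /inner_along
  ?inner0l ?inner0r ?mxE ?mul0r ?mulr0 ?addr0 ?add0r //= ?mulr1 //.
exact: unit_speed.
Qed.

Lemma normal_part_cylinder (x : 'rV[R]_2) v a : A (x 0 0) ->
  normal_part f i x (row_mx v a) =
  horizontal (v - inner_along c i (x 0 0) v (velocity c i (x 0 0)) *:
                  velocity c i (x 0 0)).
Proof.
move=> Ax; have [p0 p1] := partial_cylinder Ax.
rewrite /normal_part first_form_cylinder // invmx1 sum_id_mx2.
rewrite p0 p1 !amb_cylinder /horizontal.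
have zero00 : (0 : 'rV[R]_1) 0 0 = 0 by rewrite mxE.
have one00 : (1%:M : 'rV[R]_1) 0 0 = 1 by rewrite mxE.
rewrite zero00 one00 mulr0 mulr1 addr0 {2}/inner_along inner0r add0r.
rewrite !scale_row_mx !scaler0 add_row_mx addr0 add0r opp_row_mx add_row_mx.
by rewrite scalemx1 -mx11_scalar subrr.
Qed.

(** A field whose horizontal part depends only on the curve parameter and whose
    vertical part is constant is differentiated as a field along the curve. Such
    are the coordinate fields of the cylinder and its mean curvature vector. *)
Lemma covder_cylinder (V : R -> 'rV[R]_m) (u : 'rV[R]_1)
    (X : 'rV[R]_2 -> 'rV[R]_(m + 1)) (x v : 'rV[R]_2) :
  A (x 0 0) -> derivable V (x 0 0) 1 ->
  (forall y : 'rV[R]_2, A (y 0 0) -> X y = row_mx (V (y 0 0)) u) ->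
  covder (metric (r := prodR N) i) (chart_map (r := prodR N) i \o f) X x v =
  horizontal (covder (metric i) (chart_map i \o c) V (x 0 0) (v 0 0)).
Proof.
move=> Ax dV XV.
have P : \forall y \near x, X y = row_mx (V ((y : 'rV[R]_2) 0 0)) u.
  by near=> y; apply: XV; near: y; exact: near_coord.
rewrite (near_eq_covder _ _ _ P).
transitivity (row_mx
    (covder (metric i) (fun y : 'rV[R]_2 => (chart_map i \o c) (y 0 0))
       (fun y => V (y 0 0)) x v)
    ('D_v (fun=> u) x)).
  apply: (@covder_prodR _ _ N _ i (fun y : 'rV[R]_2 => (chart_map i \o c) (y 0 0))
    (fun y => V (y 0 0)) (fun y => (y 0 1)%:M) (fun=> u)).
  - by rewrite derivable_comp_coord; apply: derivable_dir; exact: vel.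
  - exact: (@ex_derive _ _ _ _ _ _ _ (is_derive_coord 1 x _)).
  - by rewrite derivable_comp_coord; exact: derivable_dir.
  - exact: derivable_cst.
by rewrite derive_cst covder_comp_coord.
Unshelve. all: by end_near. Qed.

Let normal_acc s :=
  nabla c (velocity c) i s -
  inner_along c i s (nabla c (velocity c) i s) (velocity c i s) *: velocity c i s.

Lemma second_form_coef_cylinder (a b : 'I_2) (x : 'rV[R]_2) : A (x 0 0) ->
  second_form_coef f i a b x =
  if (a == 0) && (b == 0) then horizontal (normal_acc (x 0 0)) else 0.
Proof.
move=> Ax.
rewrite /second_form_coef.
case: (ord2_cases b) => ->; last first.
  rewrite (covder_cylinder (V := fun=> 0) (u := 1%:M)) //.
    rewrite covder_zero normal_part_cylinder // /inner_along inner0l scale0r subr0.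
    by rewrite andbF /horizontal row_mx0.
  by move=> y /partial_cylinder[].
rewrite (covder_cylinder (V := velocity c i) (u := 0)) //; last first.
- by move=> y /partial_cylinder[].
- exact: acc.
rewrite normal_part_cylinder // mxE eqxx /= andbT (eq_sym 0 a).
case: eqP => // _.
by rewrite covder0 /inner_along inner0l scale0r subr0 /horizontal row_mx0.
Qed.

Lemma second_form_cylinder (x X Y : 'rV[R]_2) : A (x 0 0) ->
  second_form f i x X Y = (X 0 0 * Y 0 0) *: horizontal (normal_acc (x 0 0)).
Proof.
move=> Ax; rewrite /second_form sum2_ord2.
by rewrite !second_form_coef_cylinder //= !scaler0 !addr0.
Qed.

Lemma mean_curvature_cylinder (x : 'rV[R]_2) : A (x 0 0) ->
  mean_curvature f i x = horizontal (2^-1 *: normal_acc (x 0 0)).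
Proof.
move=> Ax; rewrite /mean_curvature sum2_ord2 first_form_cylinder//.
rewrite !second_form_coef_cylinder //= !scaler0 !addr0 invmx1 mxE eqxx scale1r.
by rewrite /horizontal scale_row_mx scaler0.
Qed.

(** The hypothesis on [V] covers all parameters, not only [x], because the
    normal connection differentiates the mean curvature vector. *)
Lemma normal_connection_cylinder (V : R -> 'rV[R]_m) (a : 'I_2) (x : 'rV[R]_2) :
  A (x 0 0) -> derivable V (x 0 0) 1 ->
  (forall y : 'rV[R]_2, A (y 0 0) ->
    mean_curvature f i y = horizontal (V (y 0 0))) ->
  let W := covder (metric i) (chart_map i \o c) V (x 0 0) 1 in
  normal_connection f i x a (mean_curvature f i) =
  if a == 0 then
    horizontal (W - inner_along c i (x 0 0) W (velocity c i (x 0 0)) *: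
                    velocity c i (x 0 0))
  else 0.
Proof.
move=> Ax dV HV W; rewrite /normal_connection.
rewrite (covder_cylinder _ Ax dV HV) normal_part_cylinder //.
rewrite mxE eqxx /= (eq_sym 0 a).
case: eqP => // _.
by rewrite covder0 /inner_along inner0l scale0r subr0 /horizontal row_mx0.
Qed.

Lemma push_cylinder (x X : 'rV[R]_2) : A (x 0 0) ->
  push f i x X = row_mx (X 0 0 *: velocity c i (x 0 0)) (X 0 1)%:M.
Proof.
move=> Ax; have [p0 p1] := partial_cylinder Ax.
rewrite /push sum_ord2.
rewrite p0 p1 /horizontal !scale_row_mx !scaler0 add_row_mx addr0 add0r.
by rewrite scalemx1.
Qed.

End CylinderGeometry.

(** * The cylinder over a Frenet curve *)

Section FrenetCylinder.
Variables (R : realType) (m : nat) (N : riemannian R m).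
Variables (I : set R) (c : R -> carrier N) (r : nat).
Variables (E : nat -> chart N -> R -> 'rV[R]_m) (kappa : nat -> R -> R).
Hypothesis frenet : frenet_frame I c r E kappa.
Hypothesis r_gt0 : (0 < r)%N.
Variable i : chart N.

Let A := in_chart I c i.
Let f := cylinder c.

Lemma open_in_chart : open A.
Proof. by have [sm _ _ _ _] := frenet; have [] := sm i. Qed.

Lemma smooth_in_chart : smooth_on A (chart_map i \o c).
Proof. by have [sm _ _ _ _] := frenet; have [] := sm i. Qed.

Lemma frenet_unit_speed s : A s ->
  inner_along c i s (velocity c i s) (velocity c i s) = 1.
Proof.
move=> As; have [_ _ E1 on _] := frenet; rewrite -E1//.
by rewrite on ?eqxx ?r_gt0.
Qed.

Lemma frenet_acceleration s : A s ->
  nabla c (velocity c) i s = if (1 < r)%N then kappa 1%N s *: E 2 i s else 0.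
Proof.
move=> As; have [_ _ E1 _ fe] := frenet.
have P : \forall t \near s, velocity c i t = E 1 i t.
  near=> t; rewrite E1 //; near: t.
  by apply: open_nbhs_nbhs; split => //; exact: open_in_chart.
rewrite /nabla (near_eq_covder _ _ _ P).
by have := fe i s As 1%N; rewrite /nabla r_gt0 /= add0r => ->.
Unshelve. all: by end_near. Qed.

(** The acceleration of a Frenet curve is already normal. *)
Lemma frenet_normal_acceleration s : A s ->
  nabla c (velocity c) i s -
  inner_along c i s (nabla c (velocity c) i s) (velocity c i s) *: velocity c i s
  = if (1 < r)%N then kappa 1%N s *: E 2 i s else 0.
Proof.
move=> As; have [_ _ E1 on _] := frenet; rewrite frenet_acceleration//.
case: ifP => r1; last by rewrite /inner_along inner0l scale0r subr0.
by rewrite -E1// /inner_along innerZl [inner _ _ _]on// mulr0 scale0r subr0.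
Qed.

Lemma frenet_mean_curvature (x : 'rV[R]_2) : A (x 0 0) ->
  mean_curvature f i x =
  horizontal (2^-1 *: (if (1 < r)%N then kappa 1%N (x 0 0) *: E 2 i (x 0 0) else 0)).
Proof.
move=> Ax; rewrite (mean_curvature_cylinder open_in_chart smooth_in_chart)//.
  by rewrite frenet_normal_acceleration.
exact: frenet_unit_speed.
Qed.

Lemma frenet_second_form (x X Y : 'rV[R]_2) : A (x 0 0) ->
  second_form f i x X Y =
  (X 0 0 * Y 0 0) *:
    horizontal (if (1 < r)%N then kappa 1%N (x 0 0) *: E 2 i (x 0 0) else 0).
Proof.
move=> Ax; rewrite (second_form_cylinder open_in_chart smooth_in_chart)//.
  by rewrite frenet_normal_acceleration.
exact: frenet_unit_speed.
Qed.

(** By the product rule and the second Frenet equation, the derivative of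
    kappa_1 E_2 is kappa_1' E_2 - kappa_1^2 E_1 + kappa_1 kappa_2 E_3, and the
    projection to the normal space removes the E_1 term. *)
Lemma frenet_normal_connection (a : 'I_2) (x : 'rV[R]_2) :
  A (x 0 0) -> (1 < r)%N ->
  normal_connection f i x a (mean_curvature f i) =
  if a == 0 then
    horizontal (2^-1 *: ('D_1 (kappa 1%N) (x 0 0) *: E 2 i (x 0 0) +
      if (2 < r)%N then (kappa 1%N (x 0 0) * kappa 2 (x 0 0)) *: E 3 i (x 0 0)
      else 0))
  else 0.
Proof.
move=> Ax r1; have [_ [fE fk] E1 on fe] := frenet.
set s := x 0 0 in Ax *.
have dk : derivable (kappa 1%N) s 1.
  by have [|sk _] := fk 1%N => //; exact: (@sk 0%N _ Ax.1).
have dE : derivable (E 2%N i) s 1.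
  by have [|_ sE] := fE 2%N => //; exact: (@sE i 0%N _ Ax).
have dkE := @ex_derive _ _ _ _ _ _ _ (is_derive_scale dk dE).
rewrite (normal_connection_cylinder open_in_chart smooth_in_chart
  frenet_unit_speed a Ax
  (V := fun s => 2^-1 *: (kappa 1%N s *: E 2 i s))); last first.
- by move=> y Ay; rewrite frenet_mean_curvature// r1.
- exact: derivableZ.
case: eqP => // _; congr (horizontal _).
have d2 : derivable (fun=> 2^-1 : R^o) s 1 by exact: derivable_cst.
rewrite (covder_scale _ _ d2 dkE) derive_cst scale0r add0r covder_scale//.
rewrite -[covder _ _ (E 2%N i) s 1]/(nabla c (E 2%N) i s).
rewrite fe //= -!E1 // /inner_along.
have o := on i s Ax; rewrite /inner_along in o.
set T := (if (2 < r)%N then kappa 2 s *: E 3 i s else 0 : 'rV[R]_m).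
have TE1 : inner (metric i (chart_map i (c s))) T (E 1%N i s) = 0.
  rewrite /T; case: ifP => [r2|_]; last exact: inner0l.
  by rewrite innerZl o // mulr0.
have -> : (if (2 < r)%N then (kappa 1%N s * kappa 2 s) *: E 3 i s else 0) =
    kappa 1%N s *: T.
  by rewrite /T; case: ifP => _; rewrite ?scalerA ?scaler0.
rewrite -/s innerZl !(innerDl, innerZl, o, TE1) //=.
by apply/rowP => j; rewrite !mxE; ring.
Qed.

End FrenetCylinder.

Arguments open_in_chart {R m N I c r E kappa} frenet i.
Arguments smooth_in_chart {R m N I c r E kappa} frenet i.
Arguments frenet_unit_speed {R m N I c r E kappa} frenet r_gt0 i.

Section ParallelMeanCurvature.
Variables (R : realType) (m : nat) (N : riemannian R m).
Variables (I : set R) (c : R -> carrier N) (r : nat).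
Variables (E : nat -> chart N -> R -> 'rV[R]_m) (kappa : nat -> R -> R).
Hypothesis frenet : frenet_frame I c r E kappa.
Hypothesis charted : forall p : carrier N, exists i, chart_dom i p.

(** Pairing the normal derivative kappa_1' E_2 + kappa_1 kappa_2 E_3 with E_3
    bounds the order by 2, and pairing it with E_2 shows kappa_1' = 0. The charts
    must cover [N] because the surface conditions are only stated in charts. *)
Lemma nonzero_parallel_cylinder : (0 < r)%N -> I !=set0 ->
  nonzero_parallel_mean_curvature (cylinder_dom I) (cylinder c) <->
  r = 2%N /\ forall s, I s -> is_derive s 1 (kappa 1%N) 0.
Proof.
move=> r0 [s0 Is0]; have [_ [_ fk] _ on _] := frenet.
have frameneq i s j : in_chart I c i s -> (0 < j <= r)%N -> E j i s != 0.
  move=> As jr; have := on i s As j j jr jr; rewrite eqxx => + ; apply: contra_eqN.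
  by move/eqP ->; rewrite /inner_along inner0l eq_sym oner_eq0.
split=> [H|[r2 k'] i x Ix ix].
- have at_ s : I s -> exists2 i, in_chart I c i s &
    mean_curvature (cylinder c) i (const_mx s : 'rV[R]_2) <> 0 /\
    forall a, normal_connection (cylinder c) i (const_mx s : 'rV[R]_2) a
      (mean_curvature (cylinder c) i) = 0.
    move=> Is; have [i ci] := charted (c s); exists i => //.
    by apply: H; rewrite /cylinder_dom /= mxE.
  have r1 : (1 < r)%N.
    have [i As [+ _]] := at_ _ Is0.
    rewrite (frenet_mean_curvature frenet) ?mxE//; case: ifP => // _ [].
    by rewrite scaler0 /horizontal row_mx0.
  have key s : I s -> (2 < r)%N = false /\ 'D_1 (kappa 1%N) s = 0.
    move=> Is; have [i As [_ /(_ 0)]] := at_ _ Is.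
    rewrite (frenet_normal_connection frenet) ?mxE// eqxx => /horizontal_eq0 /eqP.
    rewrite scaler_eq0 invr_eq0 pnatr_eq0 /= => /eqP Z.
    have ip j : (0 < j <= r)%N ->
      inner_along c i s ('D_1 (kappa 1%N) s *: E 2%N i s +
      if (2 < r)%N then (kappa 1%N s * kappa 2 s) *: E 3 i s else 0) (E j i s) = 0.
      by move=> _; rewrite Z /inner_along inner0l.
    have o := on i s As; rewrite /inner_along in o, ip.
    have r2 : (2 < r)%N = false.
      apply/negP => r2; have := ip 3%N; rewrite r2 innerDl !innerZl !o // => /(_ isT).
      rewrite /= mulr0 add0r mulr1 => /eqP; rewrite mulf_eq0 !gt_eqF //.
      + by have [|_] := fk 2%N; [|exact].
      + by have [|_] := fk 1%N; [|exact].
    split=> //; have := ip 2%N; rewrite r2 addr0 innerZl o // => /(_ r1).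
    by rewrite mulr1.
  split=> [|s Is].
    by apply/eqP; rewrite eqn_leq r1 andbT leqNgt; have [-> _] := key _ Is0.
  have [_ <-] := key _ Is; apply: derivableP.
  by have [|sk _] := fk 1%N => //; exact: (@sk 0%N _ Is).
- have r1 : (1 < r)%N by rewrite r2.
  have Ax : in_chart I c i (x 0 0) by [].
  split=> [|a].
  + rewrite (frenet_mean_curvature frenet)// r1 => /horizontal_eq0 /eqP.
    rewrite !scaler_eq0 invr_eq0 pnatr_eq0 /=.
    rewrite (negbTE (frameneq _ _ _ Ax _)) ?orbF// gt_eqF//.
    by have [|_] := fk 1%N; [|exact].
  + rewrite (frenet_normal_connection frenet)//; case: eqP => // _.
    have [_ ->] := k' _ Ix; rewrite scale0r add0r r2 /= scaler0.
    by rewrite /horizontal row_mx0.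
Qed.

End ParallelMeanCurvature.

(** * The complex structure of the space forms *)

Section SpaceForms.
Variables (R : realType) (n : nat) (rho : R).
Let M := space_form n rho.

Lemma mulJ_trJ : Jmx R n *m (Jmx R n)^T = 1%:M.
Proof.
rewrite /Jmx tr_block_mx mulmx_block !linear0 !(mulmx0, mul0mx, addr0, add0r).
by rewrite trmx1 mulmx1 linearN /= trmx1 mulmxN mulNmx opprK mulmx1 -scalar_mx_block.
Qed.

Lemma trJ : (Jmx R n)^T = - Jmx R n.
Proof.
by rewrite /Jmx tr_block_mx opp_block_mx !trmx0 !oppr0 linearN /= !trmx1 opprK.
Qed.

(** J maps z to zJ and zJ to - z, hence exchanges the two rank-one terms of the
    metric. *)
Lemma space_form_metric_J (z : 'rV[R]_(n + n)) :
  Jmx R n *m space_form_metric rho z *m (Jmx R n)^T = space_form_metric rho z.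
Proof.
rewrite /space_form_metric.
rewrite -scalemxAr -scalemxAl; congr (_ *: _).
rewrite mulmxBr mulmxBl -!scalemxAr -!scalemxAl mulmx1 mulJ_trJ; congr (_ - _ *: _).
rewrite mulmxDr mulmxDl addrC; congr (_ + _).
  rewrite trmx_mul !mulmxA mulJ_trJ mul1mx -!mulmxA.
  by rewrite mulJ_trJ mulmx1.
by rewrite !trmx_mul !mulmxA trJ !mulmxN !mulNmx.
Qed.

Lemma space_form_J_isometry (i : chart M) z :
  Jmx R n *m metric i z *m (Jmx R n)^T = metric i z.
Proof.
move: i z; rewrite /M /space_form; case: ifP => _; last case: ifP => _.
- by move=> i z; exact: space_form_metric_J.
- by move=> i z; exact: space_form_metric_J.
- by move=> i z; rewrite /= mulmx1 mulJ_trJ.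
Qed.

Lemma inner_J (i : chart M) z (v w : 'rV[R]_(n + n)) :
  inner (metric i z) (v *m Jmx R n) w = - inner (metric i z) v (w *m Jmx R n).
Proof.
have JG : Jmx R n *m metric i z = metric i z *m Jmx R n.
  rewrite -[in RHS](space_form_J_isometry i z) -[RHS]mulmxA.
  by rewrite trJ mulNmx -mulmxN -trJ mulJ_trJ mulmx1.
rewrite /inner -(mulmxA v) JG trmx_mul trJ.
by rewrite mulNmx mulmxN [in RHS]mxE opprK !mulmxA.
Qed.

(** In projective space: a spanning vector of a line has a non-zero
    coordinate. *)
Lemma space_form_charted (p : carrier M) : exists i, chart_dom i p.
Proof.
move: p; rewrite /M /space_form; case: ifP => _; last case: ifP => _.
- move=> [L dimL] /=.
  have : vpick L != 0.
    by rewrite vpick0 -dimv_eq0 (eqP dimL).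
  apply: contraPP => no; apply/negP; rewrite negbK; apply/eqP/rowP => j.
  by rewrite mxE; apply/eqP; apply: contrapT => /negP nz; apply: no; exists j.
- by move=> p; exists tt.
- by move=> p; exists tt.
Qed.

End SpaceForms.

(** * The quadratic form on the cylinder *)

(** A multiple of the Euclidean metric vanishes on a - i b when a and b are
    orthogonal of equal length. *)
Lemma complex_ext_conformal (R : realType) (q : 'rV[R]_2 -> 'rV[R]_2 -> R)
    (alpha u : R) (a b : 'rV[R]_2) :
  (forall X Y, q X Y = alpha * (X 0 0 * Y 0 0 + X 0 1 * Y 0 1)) ->
  a 0 0 * a 0 0 + a 0 1 * a 0 1 = b 0 0 * b 0 0 + b 0 1 * b 0 1 ->
  a 0 0 * b 0 0 + a 0 1 * b 0 1 = 0 ->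
  complex_ext q (u *: a) (- u *: b) = 0.
Proof.
move=> qE e1 e2; rewrite /complex_ext !qE !mxE.
apply/eqP; rewrite eq_complex; apply/andP; split; apply/eqP => /=.
- transitivity (alpha * u ^+ 2 * ((a 0 0 * a 0 0 + a 0 1 * a 0 1) -
    (b 0 0 * b 0 0 + b 0 1 * b 0 1))); first by ring.
  by rewrite e1 subrr mulr0.
- transitivity (- 2 * alpha * u ^+ 2 * (a 0 0 * b 0 0 + a 0 1 * b 0 1)); first by ring.
  by rewrite e2 mulr0.
Qed.

Section HopfForm.
Variables (R : realType) (n : nat) (rho : R).
Variables (I : set R) (gamma : R -> carrier (space_form n rho)) (r : nat).
Variables (E : nat -> chart (space_form n rho) -> R -> 'rV[R]_(n + n)).
Variables (kappa : nat -> R -> R).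
Hypothesis frenet : frenet_frame I gamma r E kappa.
Hypothesis r_gt1 : (1 < r)%N.

Let r_gt0 : (0 < r)%N := ltnW r_gt1.
Let f := cylinder gamma.

Lemma Qform_cylinder i (x X Y : 'rV[R]_2) :
  in_chart I gamma i (x 0 0) ->
  let k := kappa 1%N (x 0 0) in
  let tau := complex_torsion gamma E i (x 0 0) in
  Qform f i x X Y =
  k ^+ 2 * (k ^+ 2 + 3 / 4 * rho * tau ^+ 2) * (X 0 0 * Y 0 0)
  - rho * k ^+ 2 / 4 * (X 0 1 * Y 0 1).
Proof.
move=> Ax k tau; have [_ _ E1 on _] := frenet.
have o := on i _ Ax.
pose e := E 2%N i (x 0 0).
have zero00 : (0 : 'rV[R]_1) 0 0 = 0 by rewrite mxE.
have Hx : mean_curvature f i x = row_mx ((k / 2) *: e) 0.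
  by rewrite (frenet_mean_curvature frenet)// r_gt1 scalerA mulrC.
have Sx : second_form f i x X Y = row_mx ((X 0 0 * Y 0 0 * k) *: e) 0.
  rewrite (frenet_second_form frenet)// r_gt1 /horizontal.
  by rewrite scale_row_mx scaler0 scalerA.
have px Z : push f i x Z = row_mx (Z 0 0 *: E 1%N i (x 0 0)) (Z 0 1)%:M.
  rewrite (push_cylinder (smooth_in_chart frenet i) _ Ax).
  by rewrite E1.
have etax Z : eta (push f i x Z) = Z 0 1.
  by rewrite /eta px row_mxKr mxE eqxx mulr1n.
have eJe : inner_along gamma i (x 0 0) (E 1%N i (x 0 0) *m Jmx R n) e = - tau.
  exact: inner_J.
have phix Z : amb f i x (phi (push f i x Z)) (mean_curvature f i x) =
    - (Z 0 0 * (k / 2) * tau).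
  rewrite Hx px /phi row_mxKl amb_cylinder zero00 mulr0 addr0 -scalemxAl.
  by rewrite /inner_along innerZl innerZr [inner _ _ _]eJe; ring.
have ee : inner_along gamma i (x 0 0) e e = 1 by rewrite o.
rewrite /Qform !phix !etax Sx Hx !amb_cylinder zero00 mulr0 !addr0.
rewrite /inner_along !innerZl !innerZr [inner _ e e]ee.
by field.
Qed.

Lemma induced_cylinder i (x X Y : 'rV[R]_2) : in_chart I gamma i (x 0 0) ->
  Defs.induced f i x X Y = X 0 0 * Y 0 0 + X 0 1 * Y 0 1.
Proof.
move=> Ax; rewrite /Defs.induced.
rewrite (first_form_cylinder (smooth_in_chart frenet i)
  (frenet_unit_speed frenet r_gt0 i) Ax).
exact: inner_id2.
Qed.

(** In one direction the identity of the parameter domain is an isothermal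
    parametrization, whose condition compares the diagonal entries of [Qform]. In
    the other, equal diagonal entries make [Qform] a multiple of the metric, so that the
    condition holds in every isothermal parametrization. *)
Lemma part20_cylinder : open I ->
  part20_vanishes (cylinder_dom I) f (Qform f) <->
  forall i s, in_chart I gamma i s ->
    4 * kappa 1%N s ^+ 2 = - rho * (1 + 3 * complex_torsion gamma E i s ^+ 2).
Proof.
move=> oI; have [_ [_ fk] _ _ _] := frenet.
have kpos s : I s -> 0 < kappa 1%N s by have [|_] := fk 1%N; [|exact].
split=> [Q0 i s As|Hk W psi [_ _ Wpsi Wiso] w Ww i iw].
- have iso : isothermal (cylinder_dom I) f (cylinder_dom I) id.
    split=> [||w Iw|w Iw j jw du dv].
    + exact: open_coord.
    + by move=> ? ? _ _.
    + by split; [exact: Iw|apply: ex_diff].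
    + have du_ : du = delta_mx 0 0 by exact: derive_id.
      have dv_ : dv = delta_mx 0 1 by exact: derive_id.
      have Aw : in_chart I gamma j (w 0 0) by [].
      rewrite du_ dv_ !(induced_cylinder _ _ Aw) !mxE /=.
      by rewrite !(mulr0, mul0r, mulr1, addr0, add0r).
  have Aw : in_chart I gamma i ((const_mx s : 'rV[R]_2) 0 0) by rewrite mxE.
  have := Q0 _ _ iso (const_mx s) Aw.1 i Aw.2.
  rewrite !derive_id /complex_ext => -[+ _].
  rewrite !(Qform_cylinder _ _ Aw) !mxE /=.
  rewrite !(mulr0, mul0r, mulr1, addr0, add0r, subr0, sub0r) mulrNN.
  rewrite -!invfM -!expr2 sqr_sqrtr ?ler0n//.
  have := kpos s As.1; set k := kappa 1%N s; set t := complex_torsion _ _ _ _ => k0 H.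
  apply: (@mulfI _ (k ^+ 2)); first by rewrite expf_neq0// gt_eqF.
  lra.
- have [Iw _] := Wpsi _ Ww.
  have Aw : in_chart I gamma i (psi w 0 0) := conj Iw iw.
  have := Wiso _ Ww i iw; move: ('D_(delta_mx 0 0) psi w) ('D_(delta_mx 0 1) psi w).
  move=> a b /= [_ e1 e2]; move: (psi w) Aw e1 e2 => x Ax e1 e2.
  rewrite !(induced_cylinder _ _ Ax) in e1 e2.
  apply: (complex_ext_conformal (alpha := - (rho * kappa 1%N (x 0 0) ^+ 2 / 4))) e1 e2.
  move=> X Y; rewrite (Qform_cylinder _ _ Ax).
  set k := kappa 1%N _; set t := complex_torsion _ _ _ _.
  have H : 4 * k ^+ 2 = - rho * (1 + 3 * t ^+ 2) by exact: Hk.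
  have -> : k ^+ 2 * (k ^+ 2 + 3 / 4 * rho * t ^+ 2) = - (rho * k ^+ 2 / 4).
    transitivity (k ^+ 2 * (4 * k ^+ 2 + 3 * rho * t ^+ 2) / 4); first by field.
    by rewrite H; field.
  by ring.
Qed.

End HopfForm.

(** * Characterization of the cylinders *)

Lemma smooth_on_cst (R : realType) (W : normedModType R) (A : set R) (k : W) :
  smooth_on A (fun=> k).
Proof.
move=> l s _; elim: l k => [|l IH] k; first exact: derivable_cst.
rewrite derive1Sn (_ : derive1 _ = fun=> 0); first exact: IH.
by apply/funext => t; rewrite derive1E derive_cst.
Qed.

Theorem proposition4p1 (R : realType) (n : nat) (rho : R) (I : set R)
    (gamma : R -> carrier (space_form n rho)) (r : nat) :
  open I -> is_interval I -> I !=set0 ->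
  frenet_curve I gamma r ->
  (nonzero_parallel_mean_curvature (cylinder_dom I) (cylinder gamma) /\
   part20_vanishes (cylinder_dom I) (cylinder gamma) (Qform (cylinder gamma)))
  <->
  (rho < 0 /\
   exists E k,
     circle_frame I gamma E k /\
     forall i s, in_chart I gamma i s ->
       k = 2^-1 *
           Num.sqrt (- rho * (1 + 3 * complex_torsion gamma E i s ^+ 2))).
Proof.
move=> oI iI [s0 Is0] [/andP[r0 _] [E [kappa frenet]]].
have ch := @space_form_charted R n rho.
split=> [[/(nonzero_parallel_cylinder frenet ch r0 (ex_intro _ s0 Is0)) [r2 k']]|].
- subst r => /(part20_cylinder frenet isT oI) Q.
  have [sm [fE fk] E1 on fe] := frenet.
  have kpos s : I s -> 0 < kappa 1%N s by have [|_] := fk 1%N; [|exact].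
  have kcst s : I s -> kappa 1%N s = kappa 1%N s0.
    by move=> Is; apply: (constant_of_derive0 iI k'); rewrite inE.
  split.
    have [i ci] := ch (gamma s0); have := Q i s0 (conj Is0 ci).
    set t := complex_torsion _ _ _ _; have k0 := kpos _ Is0 => H.
    have k2 : 0 < kappa 1%N s0 ^+ 2 by rewrite exprn_gt0.
    have t2 : 0 < 1 + 3 * t ^+ 2 by rewrite ltr_pwDl// mulr_ge0 ?sqr_ge0 ?ler0n.
    by rewrite -oppr_gt0 -(pmulr_lgt0 _ t2) -H mulr_gt0 ?ltr0n.
  exists E, (kappa 1%N s0); split.
    split=> //.
      split=> // j _; split=> [|s Is]; first exact: smooth_on_cst.
      exact: kpos.
    move=> i s As j jr; rewrite fe //.
    by case: j jr => [|[|[|//]]] //= _; rewrite (kcst s As.1).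
  move=> i s As; rewrite -(Q i s As) -[4]/((2 * 2)%:R) natrM -expr2 -exprMn sqrtr_sqr.
  rewrite ger0_norm ?mulr_ge0 ?ler0n ?(ltW (kpos _ As.1))//.
  by rewrite mulKf// kcst//; exact: As.1.
- move=> [rho0 [F [k [circ Hk]]]].
  split.
    apply/(nonzero_parallel_cylinder circ ch isT (ex_intro _ s0 Is0)); split=> // s _.
    exact: is_derive_cst.
  apply/(part20_cylinder circ isT oI) => i s As.
  rewrite [in LHS](Hk i s As) exprMn sqr_sqrtr; first by field.
  rewrite mulr_ge0 ?oppr_ge0 ?(ltW rho0)// addr_ge0 ?ler01//.
  by rewrite mulr_ge0 ?ler0n ?sqr_ge0.
Qed.
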